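(* Let $\mathcal{R}:\mathfrak{g}\to\mathfrak{g}$ be a Rota-Baxter operator of weight $0$ on a noncommutative $3$-BiHom-Poisson color algebra $(\mathfrak{g},\{\cdot,\cdot,\cdot\},\mu,\epsilon,\alpha,\beta)$. Define, for $x,y,z\in\mathcal{H}(\mathfrak{g})$, $$\mu_{\mathcal{R}}(x,y)=\mu(\mathcal{R}(x),y)+\mu(x,\mathcal{R}(y)),$$ $$\{x,y,z\}_{\mathcal{R}}=\{\mathcal{R}(x),\mathcal{R}(y),z\}+\{\mathcal{R}(x),y,\mathcal{R}(z)\}+\{x,\mathcal{R}(y),\mathcal{R}(z)\}.$$ Then $(\mathfrak{g},\{\cdot,\cdot,\cdot\}_{\mathcal{R}},\mu_{\mathcal{R}},\epsilon,\alpha,\beta)$ is a noncommutative $3$-BiHom-Poisson color algebra.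
   Context: $\mathbb{K}$ is an algebraically closed field of characteristic zero and $\Gamma$ is an abelian group. For a $\Gamma$-graded vector space $V=\bigoplus_{a\in\Gamma}V_a$, $\mathcal{H}(V)$ is the set of homogeneous elements. A linear or multilinear map between graded spaces is even if it has degree zero. A skew-symmetric bicharacter is a map $\epsilon:\Gamma\times\Gamma\to\mathbb{K}^*$ with $\epsilon(a,a')\epsilon(a',a)=1$, $\epsilon(a,a'+a'')=\epsilon(a,a')\epsilon(a,a'')$, $\epsilon(a+a',a'')=\epsilon(a,a'')\epsilon(a',a'')$. For homogeneous $x,y,z$ of degrees $a,b,c$ write $\epsilon(x,y)=\epsilon(a,b)$, $\epsilon(x+y,z)=\epsilon(a+b,c)$, etc. All identities below are for homogeneous elements. BiHom-associative color algebra $(\mathfrak{g},\mu,\epsilon,\alpha,\beta)$: a $\Gamma$-graded space with an even bilinear $\mu$ and even commuting linear maps $\alpha,\beta$ such that $\alpha(\mu(x,y))=\mu(\alpha(x),\alpha(y))$, $\beta(\mu(x,y))=\mu(\beta(x),\beta(y))$, $\mu(\alpha(x),\mu(y,z))=\mu(\mu(x,y),\beta(z))$. $3$-BiHom-Lie color algebra $(\mathfrak{g},[\cdot,\cdot,\cdot],\epsilon,\alpha,\beta)$: a $\Gamma$-graded space with an even trilinear bracket and even linear maps $\alpha,\beta$ such that $[\beta(x),\beta(y),\alpha(z)]=-\epsilon(x,y)[\beta(y),\beta(x),\alpha(z)]$, $[\beta(x),\beta(y),\alpha(z)]=-\epsilon(y,z)[\beta(x),\beta(z),\alpha(y)]$,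 and $[\beta^2(x),\beta^2(y),[\beta(z),\beta(u),\alpha(v)]]=\epsilon(x+y+z,u+v)[\beta^2(u),\beta^2(v),[\beta(x),\beta(y),\alpha(z)]]-\epsilon(x+y,z+v)\epsilon(u,v)[\beta^2(z),\beta^2(v),[\beta(x),\beta(y),\alpha(u)]]+\epsilon(x+y,z+u)[\beta^2(z),\beta^2(u),[\beta(x),\beta(y),\alpha(v)]]$. Noncommutative $3$-BiHom-Poisson color algebra $(\mathfrak{g},\{\cdot,\cdot,\cdot\},\mu,\epsilon,\alpha,\beta)$: $(\mathfrak{g},\mu,\epsilon,\alpha,\beta)$ is a BiHom-associative color algebra, $(\mathfrak{g},\{\cdot,\cdot,\cdot\},\epsilon,\alpha,\beta)$ is a $3$-BiHom-Lie color algebra, and $\{\alpha\beta(x),\alpha\beta(y),\mu(z,t)\}=\mu(\{\beta(x),\beta(y),z\},\beta(t))+\epsilon(x+y,z)\mu(\beta(z),\{\alpha(x),\alpha(y),t\})$. A Rota-Baxter operator of weight $0$ on it is an even linear map $\mathcal{R}:\mathfrak{g}\to\mathfrak{g}$ commuting with $\alpha$ and $\beta$ such that $\mu(\mathcal{R}(x),\mathcal{R}(y))=\mathcal{R}(\mu(\mathcal{R}(x),y)+\mu(x,\mathcal{R}(y)))$ and $\{\mathcal{R}(x),\mathcal{R}(y),\mathcal{R}(z)\}=\mathcal{R}(\{\mathcal{R}(x),\mathcal{R}(y),z\}+\{\mathcal{R}(x),y,\mathcal{R}(z)\}+\{x,\mathcal{R}(y),\mathcal{R}(z)\})$. *)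

(* Defs.v *)
From HB Require Import structures.
From mathcomp Require Import all_boot all_order all_algebra.

Set Implicit Arguments.
Unset Strict Implicit.
Unset Printing Implicit Defensive.

Import GRing.Theory.
Local Open Scope ring_scope.

(* An internal direct sum decomposition g = \bigoplus_(a : G) V_a, where
   [homog V a x] means x \in V_a. Neither G nor g is assumed finite
   (dimensional), hence the finite families [s] in the last two fields.
   The zero vector is homogeneous of every degree. *)
Record grading (K : fieldType) (G : zmodType) (g : lmodType K) := Grading {
  homog :> G -> g -> Prop;
  homog0 : forall a, homog a 0;
  homogD : forall a x y, homog a x -> homog a y -> homog a (x + y);
  homogZ : forall a (k : K) x, homog a x -> homog a (k *: x);
  homog_span : forall v : g, exists (s : seq G) (f : G -> g),
    [/\ uniq s, forall a, homog a (f a) & v = \sum_(a <- s) f a];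
  homog_indep : forall (s : seq G) (f : G -> g),
    uniq s -> (forall a, homog a (f a)) -> \sum_(a <- s) f a = 0 ->
    forall a, a \in s -> f a = 0
}.

Record skew_bicharacter (K : fieldType) (G : zmodType) := SkewBicharacter {
  bichar :> G -> G -> K;
  bichar_neq0 : forall a b, bichar a b != 0;
  bichar_skew : forall a b, bichar a b * bichar b a = 1;
  bicharDr : forall a b c, bichar a (b + c) = bichar a b * bichar a c;
  bicharDl : forall a b c, bichar (a + b) c = bichar a c * bichar b c
}.

Definition bilinear_map (K : fieldType) (g : lmodType K) (f : g -> g -> g) :=
  (forall y, linear (fun x => f x y)) /\ (forall x, linear (f x)).

Definition trilinear_map (K : fieldType) (g : lmodType K)
    (f : g -> g -> g -> g) :=
  [/\ forall y z, linear (fun x => f x y z),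
      forall x z, linear (fun y => f x y z) &
      forall x y, linear (f x y)].

Section Structures.

Variables (K : fieldType) (G : zmodType) (g : lmodType K).
Variables (V : grading G g) (eps : skew_bicharacter K G).

Definition even1 (f : g -> g) := forall a x, V a x -> V a (f x).

Definition even2 (f : g -> g -> g) :=
  forall a b x y, V a x -> V b y -> V (a + b) (f x y).

Definition even3 (f : g -> g -> g -> g) :=
  forall a b c x y z, V a x -> V b y -> V c z -> V (a + b + c) (f x y z).

(* The axioms of a BiHom-associative color algebra do not involve eps. *)
Record BiHom_assoc_color (mu : g -> g -> g) (alpha beta : {linear g -> g})
    : Prop := BiHomAssocColor {
  bha_bilinear : bilinear_map mu;
  bha_even : even2 mu;
  bha_even_alpha : even1 alpha;
  bha_even_beta : even1 beta;
  bha_comm : forall x, alpha (beta x) = beta (alpha x);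
  bha_alphaM : forall a b x y, V a x -> V b y ->
    alpha (mu x y) = mu (alpha x) (alpha y);
  bha_betaM : forall a b x y, V a x -> V b y ->
    beta (mu x y) = mu (beta x) (beta y);
  bha_assoc : forall a b c x y z, V a x -> V b y -> V c z ->
    mu (alpha x) (mu y z) = mu (mu x y) (beta z)
}.

Record BiHom_Lie3_color (br : g -> g -> g -> g) (alpha beta : {linear g -> g})
    : Prop := BiHomLie3Color {
  bhl_trilinear : trilinear_map br;
  bhl_even : even3 br;
  bhl_even_alpha : even1 alpha;
  bhl_even_beta : even1 beta;
  bhl_skew12 : forall a b c x y z, V a x -> V b y -> V c z ->
    br (beta x) (beta y) (alpha z)
      = - (eps a b *: br (beta y) (beta x) (alpha z));
  bhl_skew23 : forall a b c x y z, V a x -> V b y -> V c z ->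
    br (beta x) (beta y) (alpha z)
      = - (eps b c *: br (beta x) (beta z) (alpha y));
  bhl_jacobi : forall a b c d e x y z u v,
    V a x -> V b y -> V c z -> V d u -> V e v ->
    br (beta (beta x)) (beta (beta y)) (br (beta z) (beta u) (alpha v))
      = eps (a + b + c) (d + e) *:
          br (beta (beta u)) (beta (beta v)) (br (beta x) (beta y) (alpha z))
      - (eps (a + b) (c + e) * eps d e) *:
          br (beta (beta z)) (beta (beta v)) (br (beta x) (beta y) (alpha u))
      + eps (a + b) (c + d) *:
          br (beta (beta z)) (beta (beta u)) (br (beta x) (beta y) (alpha v))
}.

Record nc_BiHom_Poisson3_color (br : g -> g -> g -> g) (mu : g -> g -> g)
    (alpha beta : {linear g -> g}) : Prop := NCBiHomPoisson3Color {
  bhp_assoc : BiHom_assoc_color mu alpha beta;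
  bhp_Lie3 : BiHom_Lie3_color br alpha beta;
  bhp_Leibniz : forall a b c d x y z t,
    V a x -> V b y -> V c z -> V d t ->
    br (alpha (beta x)) (alpha (beta y)) (mu z t)
      = mu (br (beta x) (beta y) z) (beta t)
      + eps (a + b) c *: mu (beta z) (br (alpha x) (alpha y) t)
}.

Record Rota_Baxter0 (br : g -> g -> g -> g) (mu : g -> g -> g)
    (alpha beta R : {linear g -> g}) : Prop := RotaBaxter0 {
  rb_even : even1 R;
  rb_alpha : forall x, R (alpha x) = alpha (R x);
  rb_beta : forall x, R (beta x) = beta (R x);
  rb_mul : forall a b x y, V a x -> V b y ->
    mu (R x) (R y) = R (mu (R x) y + mu x (R y));
  rb_bracket : forall a b c x y z, V a x -> V b y -> V c z ->
    br (R x) (R y) (R z)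
      = R (br (R x) (R y) z + br (R x) y (R z) + br x (R y) (R z))
}.

End Structures.

(* These formulas are multilinear, so on all of g they give the unique
   multilinear extension of their restriction to homogeneous elements. *)
Definition muR (K : fieldType) (g : lmodType K) (R : g -> g)
    (mu : g -> g -> g) (x y : g) : g :=
  mu (R x) y + mu x (R y).

Definition brR (K : fieldType) (g : lmodType K) (R : g -> g)
    (br : g -> g -> g -> g) (x y z : g) : g :=
  br (R x) (R y) z + br (R x) y (R z) + br x (R y) (R z).

(* Main.v *)
Require Import Defs.
From mathcomp Require Import all_boot all_order all_algebra.
Local Open Scope ring_scope.

(* The operator [R] is a morphism from the new products to the old ones. Hence
   an iterated new product of n variables expands, by multilinearity, into the
   sum over the variables w of the iterated old product in which [R] is applied
   to every variable except w. Since [R] commutes with [alpha] and [beta], each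
   identity for the new products is the sum over w of the corresponding
   identity for the old ones. *)

Set Implicit Arguments.
Unset Strict Implicit.
Unset Printing Implicit Defensive.

Import GRing.Theory.

(** Serves to gather several instances of the Jacobi identity term by term, so that each coefficient
    can be factored out. *)
Lemma addrDBD (U : zmodType) (x y z x' y' z' : U) :
  (x - y + z) + (x' - y' + z') = (x + x') - (y + y') + (z + z').
Proof. by rewrite addrACA [X in X + _]addrACA opprD. Qed.

Section RotaBaxterTwist.

Variables (K : fieldType) (G : zmodType) (g : lmodType K).
Variables (V : grading G g) (eps : skew_bicharacter K G).
Variables (br : g -> g -> g -> g) (mu : g -> g -> g).
Variables (alpha beta R : {linear g -> g}).

Lemma linearfD (f : g -> g) : linear f -> {morph f : x y / x + y}.
Proof. by move=> fL x y; have := fL 1 x y; rewrite !scale1r. Qed.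

Lemma linear_add (f h : g -> g) :
  linear f -> linear h -> linear (fun x => f x + h x).
Proof. by move=> fL hL k x y; rewrite fL hL scalerDr addrACA. Qed.

Lemma linear_comp (f h : g -> g) :
  linear f -> linear h -> linear (fun x => f (h x)).
Proof. by move=> fL hL k x y; rewrite hL fL. Qed.

Lemma muR_bilinear : bilinear_map mu -> bilinear_map (muR R mu).
Proof.
move=> [l1 l2]; split=> [y|x]; apply: linear_add => //;
  by [apply: (linear_comp (l1 _)); exact: linearP
     |apply: (linear_comp (l2 _)); exact: linearP].
Qed.

Lemma brR_trilinear : trilinear_map br -> trilinear_map (brR R br).
Proof.
move=> [l1 l2 l3]; have RL : linear R by exact: linearP.
split=> [y z|x z|x y]; do 2?apply: linear_add => //.
- exact: (linear_comp (l1 _ _)).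
- exact: (linear_comp (l1 _ _)).
- exact: (linear_comp (l2 _ _)).
- exact: (linear_comp (l2 _ _)).
- exact: (linear_comp (l3 _ _)).
- exact: (linear_comp (l3 _ _)).
Qed.

Hypothesis hR : Rota_Baxter0 V br mu alpha beta R.

Let RV a x : V a x -> V a (R x). Proof. exact: (rb_even hR). Qed.
Let Ra x : R (alpha x) = alpha (R x). Proof. exact: (rb_alpha hR). Qed.
Let Rb x : R (beta x) = beta (R x). Proof. exact: (rb_beta hR). Qed.

Lemma R_muR a b x y : V a x -> V b y -> R (muR R mu x y) = mu (R x) (R y).
Proof. by move=> Vx Vy; rewrite (rb_mul hR Vx Vy). Qed.

Lemma R_brR a b c x y z : V a x -> V b y -> V c z ->
  R (brR R br x y z) = br (R x) (R y) (R z).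
Proof. by move=> Vx Vy Vz; rewrite (rb_bracket hR Vx Vy Vz). Qed.

Lemma muR_BiHom_assoc : BiHom_assoc_color V mu alpha beta ->
  BiHom_assoc_color V (muR R mu) alpha beta.
Proof.
move=> [mL mV aV bV abC aM bM mA]; split=> //.
- exact: muR_bilinear.
- by move=> a b x y Vx Vy; apply: homogD; apply: mV => //; exact: RV.
- move=> a b x y Vx Vy; rewrite /muR linearD !Ra.
  by rewrite (aM _ _ _ _ (RV Vx) Vy) (aM _ _ _ _ Vx (RV Vy)).
- move=> a b x y Vx Vy; rewrite /muR linearD !Rb.
  by rewrite (bM _ _ _ _ (RV Vx) Vy) (bM _ _ _ _ Vx (RV Vy)).
have [mL1 mL2] := mL.
move=> a b c x y z Vx Vy Vz.
(* Only the outer products are unfolded at first: an inner one under [R] must stay folded for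
   [R_muR] to apply. *)
rewrite [LHS]/muR [RHS]/muR (R_muR Vy Vz) (R_muR Vx Vy) Ra Rb.
rewrite [muR R mu y z]/muR [muR R mu x y]/muR.
rewrite (linearfD (mL2 _)) (linearfD (mL1 _)).
rewrite (mA _ _ _ _ _ _ (RV Vx) (RV Vy) Vz).
rewrite (mA _ _ _ _ _ _ (RV Vx) Vy (RV Vz)).
by rewrite (mA _ _ _ _ _ _ Vx (RV Vy) (RV Vz)) [RHS]addrA.
Qed.

Lemma brR_BiHom_Lie3 : BiHom_Lie3_color V eps br alpha beta ->
  BiHom_Lie3_color V eps (brR R br) alpha beta.
Proof.
move=> [tL tV aV bV s12 s23 jac]; split=> //.
- exact: brR_trilinear.
- by move=> a b c x y z Vx Vy Vz; do 2?apply: homogD; apply: tV; auto.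
- move=> a b c x y z Vx Vy Vz; rewrite /brR !Ra !Rb.
  rewrite (s12 _ _ _ _ _ _ (RV Vx) (RV Vy) Vz).
  rewrite (s12 _ _ _ _ _ _ (RV Vx) Vy (RV Vz)).
  rewrite (s12 _ _ _ _ _ _ Vx (RV Vy) (RV Vz)).
  (* As [R] is even, all three terms carry the factor [eps a b]. Exchanging [x] and [y] exchanges
     the last two summands, where [R] misses [y] and [x]. *)
  by rewrite -!opprD -!scalerDr addrAC.
- move=> a b c x y z Vx Vy Vz; rewrite /brR !Ra !Rb.
  rewrite (s23 _ _ _ _ _ _ (RV Vx) (RV Vy) Vz).
  rewrite (s23 _ _ _ _ _ _ (RV Vx) Vy (RV Vz)).
  rewrite (s23 _ _ _ _ _ _ Vx (RV Vy) (RV Vz)).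
  by rewrite -!opprD -!scalerDr [X in X + _]addrC.
have [_ _ tL3] := tL.
(* All four double brackets of the Jacobi identity have this shape up to a permutation of the
   variables. The summands are listed with [R] missing the last variable first. *)
have expand a b c d e x y z u v : V a x -> V b y -> V c z -> V d u -> V e v ->
    brR R br (beta (beta x)) (beta (beta y))
      (brR R br (beta z) (beta u) (alpha v))
    = let B x y z u v :=
        br (beta (beta x)) (beta (beta y)) (br (beta z) (beta u) (alpha v)) in
      B (R x) (R y) (R z) (R u) v + B (R x) (R y) (R z) u (R v)
      + B (R x) (R y) z (R u) (R v) + B (R x) y (R z) (R u) (R v)
      + B x (R y) (R z) (R u) (R v).
  move=> Vx Vy Vz Vu Vv; rewrite [LHS]/brR.
  rewrite (R_brR (bV _ _ Vz) (bV _ _ Vu) (aV _ _ Vv)) /brR.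
  by rewrite !Ra !Rb !(linearfD (tL3 _ _)).
move=> a b c d e x y z u v Vx Vy Vz Vu Vv.
rewrite (expand _ _ _ _ _ _ _ _ _ _ Vx Vy Vz Vu Vv).
rewrite (expand _ _ _ _ _ _ _ _ _ _ Vu Vv Vx Vy Vz).
rewrite (expand _ _ _ _ _ _ _ _ _ _ Vz Vv Vx Vy Vu).
rewrite (expand _ _ _ _ _ _ _ _ _ _ Vz Vu Vx Vy Vv) /=.
(* The old identity, with [R] missing [v], [u], [z], [y], [x] in turn; evenness of [R] keeps the
   coefficients the same. *)
rewrite (jac _ _ _ _ _ _ _ _ _ _ (RV Vx) (RV Vy) (RV Vz) (RV Vu) Vv).
rewrite (jac _ _ _ _ _ _ _ _ _ _ (RV Vx) (RV Vy) (RV Vz) Vu (RV Vv)).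
rewrite (jac _ _ _ _ _ _ _ _ _ _ (RV Vx) (RV Vy) Vz (RV Vu) (RV Vv)).
rewrite (jac _ _ _ _ _ _ _ _ _ _ (RV Vx) Vy (RV Vz) (RV Vu) (RV Vv)).
rewrite (jac _ _ _ _ _ _ _ _ _ _ Vx (RV Vy) (RV Vz) (RV Vu) (RV Vv)).
rewrite !addrDBD -!scalerDr; congr (_ *: _ - _ *: _ + _ *: _).
(* Here [expand] was used at [u, v, x, y, z], so its summands miss [z, y, x, v, u]; the permutation
   restores the order [v, u, z, y, x]. The next two are found likewise. *)
- by rewrite [RHS](ACl (4*5*1*2*3)).
- by rewrite [RHS](ACl (4*1*5*2*3)).
- by rewrite [RHS](ACl (1*4*5*2*3)).
Qed.

Lemma brR_muR_Poisson3 : nc_BiHom_Poisson3_color V eps br mu alpha beta ->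
  nc_BiHom_Poisson3_color V eps (brR R br) (muR R mu) alpha beta.
Proof.
move=> [hA hL leib]; split; [exact: muR_BiHom_assoc|exact: brR_BiHom_Lie3|].
have [mL1 mL2] := bha_bilinear hA; have [_ _ tL3] := bhl_trilinear hL.
have aV := bha_even_alpha hA; have bV := bha_even_beta hA.
move=> a b c d x y z t Vx Vy Vz Vt.
rewrite [LHS]/brR [X in _ = X + _]/muR [X in _ = _ + _ *: X]/muR.
rewrite (R_muR Vz Vt) (R_brR (bV _ _ Vx) (bV _ _ Vy) Vz).
rewrite (R_brR (aV _ _ Vx) (aV _ _ Vy) Vt) /brR /muR !(Ra, Rb).
rewrite !(linearfD (tL3 _ _), linearfD (mL1 _), linearfD (mL2 _)).
rewrite (leib _ _ _ _ _ _ _ _ (RV Vx) (RV Vy) (RV Vz) Vt).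
rewrite (leib _ _ _ _ _ _ _ _ (RV Vx) (RV Vy) Vz (RV Vt)).
rewrite (leib _ _ _ _ _ _ _ _ (RV Vx) Vy (RV Vz) (RV Vt)).
rewrite (leib _ _ _ _ _ _ _ _ Vx (RV Vy) (RV Vz) (RV Vt)).
(* Three merges join the four Leibniz instances, where [R] misses [t], [z], [y], [x], into one
   unscaled sum and one sum scaled by [eps (a + b) c]. *)
do 3 rewrite (addrACA _ (_ *: _)) -scalerDr.
congr (_ + _ *: _); first by rewrite !addrA.
(* With [z] in the outer product, the right-hand summands miss [t, y, x, z] in this order. *)
by rewrite [RHS](ACl (1*4*2*3)).
Qed.

End RotaBaxterTwist.

Theorem theorem3p4 (K : closedFieldType) (charK : [pchar K] =i pred0)
    (G : zmodType) (g : lmodType K) (V : grading G g)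
    (eps : skew_bicharacter K G)
    (br : g -> g -> g -> g) (mu : g -> g -> g)
    (alpha beta R : {linear g -> g})
    (hP : nc_BiHom_Poisson3_color V eps br mu alpha beta)
    (hR : Rota_Baxter0 V br mu alpha beta R) :
  nc_BiHom_Poisson3_color V eps (brR R br) (muR R mu) alpha beta.
Proof. exact: brR_muR_Poisson3. Qed.
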